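(* Let $\mathbb{K}$ be a field and let $R=\mathbb{K}[x_1,\dots,x_k]$ be graded by $W=[d_1,\dots,d_k]$, where the $d_i$ are positive integers with $\gcd(d_1,\dots,d_k)=1$. Let $d=\operatorname{lcm}(d_1,\dots,d_k)$ and let $P_R^W=\{P_0,\dots,P_{d-1}\}$ be the Hilbert quasi-polynomial of $(R,W)$. For $r=0,\dots,k-1$, the $r$th coefficient of $P_R^W$ has periodicity equal to $$\delta_r:=\operatorname{lcm}\bigl(\gcd(d_i)_{i\in I}\ \big|\ I\subseteq\{1,\dots,k\},\ |I|=r+1\bigr);$$ that is, denoting by $a_{ir}$ the coefficient of $x^r$ in $P_i(x)$, one has $a_{jr}=a_{ir}$ for all $i,j\in\{0,\dots,d-1\}$ with $j\equiv i+\delta_r\bmod d$.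
   Context: The grading by $W$ is $\deg(x_1^{\alpha_1}\cdots x_k^{\alpha_k})=d_1\alpha_1+\cdots+d_k\alpha_k$, and the Hilbert function is $H_R^W(n)=\dim_{\mathbb{K}}(R_n)$. The Hilbert quasi-polynomial of $(R,W)$ is the unique $d$-tuple $\{P_0,\dots,P_{d-1}\}$ of polynomials in $\mathbb{Q}[x]$ such that for all sufficiently large $n$, $H_R^W(n)=P_i(n)$ where $i\in\{0,\dots,d-1\}$, $i\equiv n\bmod d$. ''Periodicity'' is meant in the formal sense spelled out in the claim (minimality of the period is not asserted). *)

(* Defs.v *)
From HB Require Import structures.
From mathcomp Require Import all_boot all_order all_algebra.
From mathcomp Require Import mpoly.

Set Implicit Arguments.
Unset Strict Implicit.
Unset Printing Implicit Defensive.

Import GRing.Theory.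

Local Open Scope ring_scope.

Section WeightedDegree.
Context (k : nat) (W : 'I_k -> nat).

Definition wdeg (m : 'X_{1..k}) : nat := (\sum_(i < k) W i * m i)%N.

Lemma wdeg0 : wdeg 0%MM = 0%N.
Proof. by rewrite /wdeg big1 // => i _; rewrite mnm0E muln0. Qed.

Lemma wdegD : {morph wdeg : m1 m2 / (m1 + m2)%MM >-> (m1 + m2)%N}.
Proof.
move=> m1 m2; rewrite /wdeg -big_split /=; apply: eq_bigr => i _.
by rewrite mnmDE mulnDr.
Qed.

HB.instance Definition _ := isMeasure.Build k wdeg wdeg0 wdegD.

Lemma mdeg_le_wdeg (m : 'X_{1..k}) :
  (forall i, (0 < W i)%N) -> (mdeg m <= wdeg m)%N.
Proof.
move=> W_gt0; rewrite mdegE /wdeg; apply: leq_sum => i _.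
exact: leq_pmull.
Qed.

End WeightedDegree.

(* The graded component R_n of R = K[x_1, ..., x_k]. The positivity proof is
   a parameter because R_n is finite-dimensional only for positive weights. *)
Record wcomp (k : nat) (K : fieldType) (W : 'I_k -> nat)
    (W_gt0 : forall i, (0 < W i)%N) (n : nat) := WComp {
  mpoly_of_wcomp :> {mpoly K[k]};
  _ : mpoly_of_wcomp \is n.-homog for (wdeg W)
}.

Arguments wcomp {k} K {W} W_gt0 n.

Section WComp.
Context (k : nat) (K : fieldType) (W : 'I_k -> nat).
Context (W_gt0 : forall i, (0 < W i)%N) (n : nat).

HB.instance Definition _ := [isSub for @mpoly_of_wcomp k K W W_gt0 n].
HB.instance Definition _ := [Choice of wcomp K W_gt0 n by <:].
HB.instance Definition _ := [SubChoice_isSubLmodule of wcomp K W_gt0 n by <:].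

Definition wmonoms : seq 'X_{1..k} :=
  [seq val m | m <- enum [pred m : 'X_{1..k < n.+1} | wdeg W m == n]].

Lemma uniq_wmonoms : uniq wmonoms.
Proof. by rewrite map_inj_uniq ?enum_uniq //; apply: val_inj. Qed.

Lemma mem_wmonoms m : (m \in wmonoms) = (wdeg W m == n).
Proof.
apply/mapP/idP => [[m' + ->]|mW]; first by rewrite mem_enum.
have lt_m : (mdeg m < n.+1)%N.
  by rewrite ltnS -(eqP mW); apply: mdeg_le_wdeg.
by exists (BMultinom lt_m); rewrite // mem_enum.
Qed.

Lemma wcomp_vecaxiom : Vector.axiom (size wmonoms) (wcomp K W_gt0 n).
Proof.
pose M (i : 'I_(size wmonoms)) := nth 0%MM wmonoms i.
have M_inj : injective M.
  move=> i j /eqP; rewrite nth_uniq ?uniq_wmonoms // => /eqP.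
  exact: val_inj.
pose f (p : wcomp K W_gt0 n) : 'rV[K]_(size wmonoms) :=
  \row_i (val p)@_(M i).
exists f => [c p q|]; first by apply/rowP=> i; rewrite !mxE mcoeffD mcoeffZ.
pose g (r : 'rV[K]_(size wmonoms)) : {mpoly K[k]} :=
  \sum_i r 0 i *: 'X_[M i].
have g_coeff r i : (g r)@_(M i) = r 0 i.
  rewrite raddf_sum (bigD1 i) //= mcoeffZ mcoeffX eqxx mulr1 big1 ?addr0 //.
  by move=> j ji; rewrite mcoeffZ mcoeffX (inj_eq M_inj) (negbTE ji) mulr0.
have g_homog r : g r \is n.-homog for (wdeg W).
  rewrite rpred_sum //= => i _; apply/rpredZ.
  by rewrite dhomogX /= -mem_wmonoms mem_nth.
exists (fun r => WComp W_gt0 (g_homog r)) => [p|r]; last first.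
  by apply/rowP => i; rewrite mxE g_coeff.
apply/val_inj/mpolyP => m /=.
have [mW|mW] := boolP (m \in wmonoms).
  have lt_m : (index m wmonoms < size wmonoms)%N by rewrite index_mem.
  have -> : m = M (Ordinal lt_m) by rewrite /M nth_index.
  by rewrite g_coeff mxE.
rewrite mem_wmonoms in mW.
by rewrite !(@dhomog_nemf_coeff _ _ (wdeg W) n) //; apply: (valP p).
Qed.

HB.instance Definition _ :=
  Lmodule_hasFinDim.Build K (wcomp K W_gt0 n) wcomp_vecaxiom.

End WComp.

Definition hilbert_fun (k : nat) (K : fieldType) (W : 'I_k -> nat)
    (W_gt0 : forall i, (0 < W i)%N) (n : nat) : nat :=
  \dim {: wcomp K W_gt0 n}.

Arguments hilbert_fun {k} K {W} W_gt0 n.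

Definition lcm_weights (k : nat) (W : 'I_k -> nat) : nat :=
  \big[lcmn/1%N]_(i < k) W i.

Definition is_hilbert_quasi_poly (k : nat) (K : fieldType) (W : 'I_k -> nat)
    (W_gt0 : forall i, (0 < W i)%N)
    (P : (lcm_weights W).-tuple {poly rat}) : Prop :=
  exists N : nat, forall (n : nat) (i : 'I_(lcm_weights W)),
    (N <= n)%N -> (i = n %[mod lcm_weights W])%N ->
    (hilbert_fun K W_gt0 n)%:R = (tnth P i).[n%:R].

Arguments is_hilbert_quasi_poly {k} K {W} W_gt0 P.

Definition quasi_period (k : nat) (W : 'I_k -> nat) (r : nat) : nat :=
  \big[lcmn/1%N]_(I : {set 'I_k} | #|I| == r.+1)
    \big[gcdn/0%N]_(i in I) W i.

(* Main.v *)
Require Import Defs.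
From mathcomp Require Import all_boot all_order all_algebra.
From mathcomp Require Import algC cyclotomic mpoly.

Import GRing.Theory Num.Theory.

Local Open Scope ring_scope.

(** The Hilbert function counts monomials by weight.  Multiplication by x_i
    injects the monomials of weight n into those of weight n + W i, and misses
    exactly those free of x_i; hence the difference operators
    f |-> f (- + W i) - f, applied for all i in turn, leave only the count of
    the monomial 1 and kill the Hilbert function in positive degrees
    (diffs_face_count, face_count_enum).

    A quasi-polynomial that vanishes eventually is zero (periodic_poly_eq0), so
    the corresponding operators kill the family (P_n) itself, extended
    periodically to all n.  Take the Fourier transform of this family in the
    residue of n modulo d: for a d-th root of unity z, let q_z be the sum of the
    z^j P_j.  The difference operator of step e acts on q_z, up to the unit z^e,
    as q |-> q (X + e) - z^e q.  This preserves the degree if z^e <> 1 and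
    lowers it by exactly one if z^e = 1 (size_twisted_diff).  Since the
    operators for the steps W i together kill q_z, the degree of q_z is smaller
    than the number of i with z^(W i) = 1 (size_fourier_poly_diffs).

    So if z contributes to the coefficients of x^r, there is a set I of r + 1
    indices with z^(W i) = 1 on I; the order of z then divides the gcd of the
    W i over I, hence quasi_period W r (expr_quasi_period).  The sequence of the
    coefficients of x^r is thus a combination of characters that have
    quasi_period W r as a period (fourier_support_period). *)

(** * Iterated differences of the Hilbert function *)

Definition diffs {V : zmodType} (es : seq nat) (f : nat -> V) : nat -> V :=
  foldr (fun e g n => g (n + e)%N - g n) f es.

Section Counting.
Context {k : nat} (W : 'I_k -> nat).

(** The Hilbert function of the quotient by the variables x_i with i in s. *)
Definition face_count (s : seq 'I_k) (n : nat) : nat :=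
  count (fun m : 'X_{1..k} => all (fun i => m i == 0%N) s) (wmonoms W n).

Lemma hilbert_funE (K : fieldType) (W_gt0 : forall i, (0 < W i)%N) n :
  hilbert_fun K W_gt0 n = face_count [::] n.
Proof. by rewrite /face_count count_predT /hilbert_fun dimvf. Qed.

Lemma wdegU i : wdeg W U_(i)%MM = W i.
Proof.
rewrite /wdeg (bigD1 i) //= mnm1E eqxx muln1 big1 ?addn0 // => j ji.
by rewrite mnm1E eq_sym (negbTE ji) muln0.
Qed.

Hypothesis W_gt0 : forall i, (0 < W i)%N.

(** Exactness of the sequence 0 -> A(- W a) -> A -> A/(x_a) -> 0, with A the
    quotient by the variables of s: a monomial free of the variables of s
    either is free of x_a as well or is x_a times another such monomial. *)
Lemma face_countD (a : 'I_k) s n : a \notin s ->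
  face_count s (n + W a) = (face_count (a :: s) (n + W a) + face_count s n)%N.
Proof.
move=> as_; rewrite /face_count -!size_filter.
set A := filter _ (wmonoms W (n + W a)); set B := filter _ _.
set C := filter _ (wmonoms W n).
rewrite -(size_map (fun m => m + U_(a))%MM C) -size_cat.
apply/perm_size/uniq_perm.
- by rewrite filter_uniq ?uniq_wmonoms.
- have inj_U : injective (fun m => m + U_(a))%MM by move=> m1 m2 /= /addIm.
  rewrite cat_uniq (map_inj_uniq inj_U) !filter_uniq ?uniq_wmonoms //= andbT.
  apply/hasPn=> _ /mapP [m' _ ->]; rewrite mem_filter /= mnmDE mnm1E eqxx.
  by rewrite addn1.
move=> m; rewrite mem_cat !mem_filter /= !mem_wmonoms //.
have [ma0|ma0] /= := eqVneq (m a) 0%N.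
  rewrite -[LHS]orbF; congr orb; apply/esym/negP => /mapP [m' _ mE].
  by move: ma0; rewrite mE mnmDE mnm1E eqxx addn1.
have Um : (U_(a) <= m)%MM.
  by apply/mnm_lepP => i; rewrite mnm1E; case: eqP => // <-; rewrite lt0n.
rewrite -(submK Um); set m' := (m - U_(a))%MM.
rewrite (mem_map (f := fun m => m + U_(a))%MM); last
  by move=> m1 m2 /= /addIm.
rewrite mem_filter mem_wmonoms // wdegD wdegU eqn_add2r; congr andb.
apply: eq_in_all => i si; rewrite mnmDE mnm1E.
by rewrite (_ : (a == i) = false) ?addn0 //; apply: contraNF as_ => /eqP->.
Qed.

(** By face_countD, each difference removes one more variable, at the price of a
    shift of the argument. *)
Lemma diffs_face_count (R : pzRingType) s n : uniq s ->
  diffs (map W s) (fun n => (face_count [::] n)%:R : R) n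
    = (face_count s (n + \sum_(i <- s) W i))%:R.
Proof.
elim: s n => [|a s IHs] n /=; first by rewrite big_nil addn0.
case/andP=> as_ us; rewrite !IHs // big_cons addnA [(n + W a + _)%N]addnAC.
by rewrite face_countD // natrD addrK.
Qed.

Lemma face_count_enum n : (0 < n)%N -> face_count (enum 'I_k) n = 0%N.
Proof.
move=> n_gt0; apply/eqP; rewrite -leqn0 leqNgt -has_count; apply/hasPn => m.
rewrite mem_wmonoms // => /eqP mn; apply/negP => /allP m0.
move: n_gt0; rewrite -mn /wdeg big1 // => i _.
by rewrite (eqP (m0 i _)) ?mem_enum // muln0.
Qed.

End Counting.

(** * Differences of quasi-polynomials *)

Section Polynomials.
Context {R : numDomainType}.
Implicit Types (q : {poly R}) (P : nat -> {poly R}).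

Lemma neq0_coef_size q i : q`_i != 0 -> (i < size q)%N.
Proof. by apply: contraNltn => /(nth_default 0) ->. Qed.

Lemma coef_exp_XaddC (a : R) m :
  (('X + a%:P) ^+ m)`_m = 1 /\ (('X + a%:P) ^+ m.+1)`_m = a *+ m.+1.
Proof.
have lead1 n : (('X + a%:P) ^+ n)`_n = 1.
  have sz : size (('X + a%:P) ^+ n) = n.+1.
    by have := size_exp_XsubC n (- a); rewrite polyCN opprK.
  have /monicP : ('X + a%:P) ^+ n \is monic by rewrite monic_exp // monicXaddC.
  by rewrite lead_coefE sz.
split=> //; elim: m => [|m IHm].
  by rewrite expr1 coefD coefX coefC add0r mulr1n.
by rewrite exprS mulrDl coefD coefXM coefCM /= IHm lead1 mulr1 -mulrSr.
Qed.

(** With l the leading coefficient of q, the top coefficient of the twisted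
    difference is (1 - c) l; if c = 1, the next one is l a (size q - 1), nonzero
    in characteristic 0. *)
Lemma size_twisted_diff q (a c : R) : a != 0 ->
  (size q <= size (q \Po ('X + a%:P) - c *: q)%R + (c == 1)%R)%N.
Proof.
move=> a_neq0; have [->|q_neq0] := eqVneq q 0; first by rewrite size_poly0.
have [->|c_neq1] := eqVneq c 1; last first.
  have lqE : (q \Po ('X + a%:P))`_(size q).-1 = lead_coef q.
    have := @lead_coef_comp _ q ('X + a%:P).
    rewrite size_XaddC lead_coefXaddC expr1n mulr1 lead_coefE.
    by rewrite size_comp_poly2 ?size_XaddC // => ->.
  rewrite addn0 -(prednK (_ : 0 < size q)%N) ?lt0n ?size_poly_eq0 //.
  apply: neq0_coef_size; rewrite coefB coefZ lqE -lead_coefE -[X in X - _]mul1r.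
  by rewrite -mulrBl mulf_neq0 ?lead_coef_eq0 // subr_eq0 eq_sym.
rewrite scale1r addn1; case sq: (size q) => [|[|m]] //.
rewrite ltnS; apply: neq0_coef_size.
rewrite coefB coef_comp_poly sq !big_ord_recr /= big1 ?add0r => [|i _].
  have [-> ->] := coef_exp_XaddC a m; rewrite mulr1 addrAC subrr add0r.
  rewrite mulf_neq0 // ?mulrn_eq0 //.
  by have := lead_coef_eq0 q; rewrite lead_coefE sq /= => ->.
rewrite [X in _ * X]nth_default ?mulr0 //.
by rewrite -[a]opprK polyCN size_exp_XsubC.
Qed.

(** The lift of diffs to families of polynomials P, where P stands for the
    sequence of the values of P n at n; see horner_poly_diffs. *)
Definition poly_diffs (es : seq nat) P : nat -> {poly R} :=
  foldr (fun e Q n => Q (n + e)%N \Po ('X + e%:R%:P) - Q n) P es.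

Lemma horner_poly_diffs es P (f : nat -> R) N :
  (forall n, (N <= n)%N -> f n = (P n).[n%:R]) ->
  forall n, (N <= n)%N -> diffs es f n = (poly_diffs es P n).[n%:R].
Proof.
move=> fP; elim: es => [|e es IHes] n Nn /=; first exact: fP.
rewrite !IHes // ?(leq_trans Nn) ?leq_addr //.
by rewrite hornerD hornerN horner_comp !hornerE natrD.
Qed.

Context (d : nat) (d_gt0 : (0 < d)%N).

Lemma periodic_mul {T : Type} (f : nat -> T) : (forall n, f (n + d)%N = f n) ->
  forall n m, f (n + m * d)%N = f n.
Proof.
move=> fd n; elim=> [|m IHm]; first by rewrite addn0.
by rewrite mulSn [(d + _)%N]addnC addnA fd.
Qed.

Lemma poly_diffs_periodic es P : (forall n, P (n + d)%N = P n) ->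
  forall n, poly_diffs es P (n + d)%N = poly_diffs es P n.
Proof. by move=> Pd; elim: es => [|e es IHes] n //=; rewrite addnAC !IHes. Qed.

(** Every large integer congruent to n modulo d is a root of P n. *)
Lemma periodic_poly_eq0 P N : (forall n, P (n + d)%N = P n) ->
  (forall n, (N <= n)%N -> (P n).[n%:R] = 0) -> forall n, P n = 0.
Proof.
move=> Pd P0 n; apply/eqP; apply: contraT => Pn_neq0.
pose x j := (n + (N + j) * d)%N.
have := max_poly_roots Pn_neq0
  (rs := [seq (x j)%:R | j <- iota 0 (size (P n))]).
rewrite size_map size_iota ltnn; apply.
  apply/allP => _ /mapP [j _ ->]; apply/rootP.
  rewrite -(periodic_mul _ Pd n (N + j)) P0 // /x.
  apply: leq_trans (leq_addl n _); rewrite -[X in (X <= _)%N]muln1.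
  by apply: leq_mul => //; apply: leq_addr.
rewrite map_inj_uniq ?iota_uniq // => i j /eqP; rewrite eqr_nat eqn_add2l.
by rewrite eqn_pmul2r // eqn_add2l => /eqP.
Qed.

Lemma sum_periodic_shift {V : zmodType} (F : nat -> V) :
  (forall n, F (n + d)%N = F n) ->
  forall e, \sum_(0 <= j < d) F (j + e)%N = \sum_(0 <= j < d) F j.
Proof.
move=> Fd; elim=> [|e IHe]; first by under eq_bigr do rewrite addn0.
have /= := erefl (\sum_(0 <= j < d.+1) F (j + e)%N).
rewrite {1}big_nat_recl // big_nat_recr //= add0n addrC addnC Fd => /addrI.
by rewrite -{}IHe => <-; apply: eq_bigr => j _; rewrite addSnnS.
Qed.

(** * Fourier transform modulo d *)

Definition fourier {V : lmodType R} (z : R) (F : nat -> V) : V :=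
  \sum_(0 <= j < d) z ^+ j *: F j.

Lemma fourier_shift {V : lmodType R} (z : R) (F : nat -> V) e :
  z ^+ d = 1 -> (forall n, F (n + d)%N = F n) ->
  z ^+ e *: fourier z (fun n => F (n + e)%N) = fourier z F.
Proof.
move=> zd Fd; rewrite /fourier scaler_sumr.
under eq_bigr do rewrite scalerA -exprD addnC.
apply: (sum_periodic_shift (fun j => z ^+ j *: F j)) => n.
by rewrite exprD zd mulr1 Fd.
Qed.

(** Each step e of the iteration turns the Fourier transform of the family into
    its difference twisted by z^e, so it lowers the size only if z^e = 1, and
    then by at most one. *)
Lemma size_fourier_poly_diffs es P (z : R) :
  z ^+ d = 1 -> (forall n, P (n + d)%N = P n) -> all (leq 1) es ->
  (size (fourier z P)
    <= size (fourier z (poly_diffs es P))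
       + count (fun e => (z ^+ e == 1)%R) es)%N.
Proof.
move=> zd Pd; elim: es => [|e es IHes] /=; first by rewrite addn0.
case/andP=> e_gt0 /IHes {}IHes; set Q := poly_diffs es P in IHes *.
have Qd : forall n, Q (n + d)%N = Q n by apply: poly_diffs_periodic.
apply: leq_trans IHes _; rewrite addnA leq_add2r.
have e_neq0 : e%:R != 0 :> R by rewrite pnatr_eq0 -lt0n.
apply: leq_trans (size_twisted_diff (fourier z Q) _ (z ^+ e) e_neq0) _.
rewrite leq_add2r -(fourier_shift z Q e zd Qd).
suff -> : (z ^+ e *: fourier z (fun n => Q (n + e)%N)) \Po ('X + e%:R%:P)
    - z ^+ e *: (z ^+ e *: fourier z (fun n => Q (n + e)%N))
  = z ^+ e *: fourier z (fun n => Q (n + e)%N \Po ('X + e%:R%:P) - Q n).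
  exact: size_scale_leq.
rewrite comp_polyZ -scalerBr fourier_shift //; congr (_ *: _).
rewrite /fourier raddf_sum -sumrB; apply: eq_bigr => j _.
by rewrite /= comp_polyZ scalerBr.
Qed.

(** The values of the Fourier transform at the powers of w are those of a
    polynomial of degree less than d, which would have d distinct roots. *)
Lemma fourier_eq0 (f : nat -> R) (w : R) : d.-primitive_root w ->
  (forall l, fourier (w ^+ l) (f : nat -> R^o) = 0) ->
  forall j, (j < d)%N -> f j = 0.
Proof.
move=> w_prim f0 j jd; pose p := \poly_(j < d) f j.
suff p0 : p = 0 by have := coef_poly d f j; rewrite -/p p0 coef0 jd.
apply/eqP; apply: contraT => p_neq0.
have := max_poly_roots p_neq0 (rs := [seq w ^+ l | l <- iota 0 d]).
rewrite size_map size_iota ltnNge size_poly /=; apply.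
  apply/allP => _ /mapP [l _ ->]; apply/rootP.
  rewrite horner_poly -[RHS](f0 l) /fourier big_mkord.
  by apply: eq_bigr => i _; rewrite mulrC.
rewrite map_inj_in_uniq ?iota_uniq // => i i'.
rewrite !mem_iota !add0n /= => id i'd /eqP.
by rewrite (eq_prim_root_expr w_prim) !modn_small // => /eqP.
Qed.

(** The Fourier transform of f (- + D) - f at z is z^(-D) - 1 times that of f,
    and at every d-th root of unity z one of these two factors vanishes. *)
Lemma fourier_support_period (f : nat -> R) (w : R) D : d.-primitive_root w ->
  (forall n, f (n + d)%N = f n) ->
  (forall z, z ^+ d = 1 -> z ^+ D != 1 -> fourier z (f : nat -> R^o) = 0) ->
  forall j, (j < d)%N -> f (j + D)%N = f j.
Proof.
move=> w_prim fd f0 j jd; apply/eqP; rewrite -subr_eq0; apply/eqP.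
suff b0 l : fourier (w ^+ l) ((fun n => f (n + D)%N - f n) : nat -> R^o) = 0.
  exact: fourier_eq0 b0 j jd.
set z := w ^+ l.
have zd : z ^+ d = 1 by rewrite exprAC (prim_expr_order w_prim) expr1n.
have -> : fourier z ((fun n => f (n + D)%N - f n) : nat -> R^o)
    = fourier z ((fun n => f (n + D)%N) : nat -> R^o)
      - fourier z (f : nat -> R^o).
  by rewrite /fourier -sumrB; apply: eq_bigr => n _; rewrite scalerBr.
have zDf := fourier_shift z (f : nat -> R^o) D zd fd.
have [zD|zD] := eqVneq (z ^+ D) 1.
  by move: zDf; rewrite zD scale1r => ->; rewrite subrr.
rewrite f0 // in zDf *; rewrite subr0.
have z_neq0 : z != 0.
  by apply: contra_eq_neq zd => ->; rewrite expr0n gtn_eqF // eq_sym oner_neq0.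
by apply: (mulfI (expf_neq0 D z_neq0)); rewrite mulr0.
Qed.

End Polynomials.

(** * Characters and the quasi-period *)

(** Among the i with z^(W i) = 1, choose r + 1: the order of z divides the gcd
    of their weights, which is one of the terms of the lcm. *)
Lemma expr_quasi_period (R : nzRingType) (k : nat) (W : 'I_k -> nat) (z : R) r :
  (exists2 n, (0 < n)%N & z ^+ n = 1) ->
  (r < #|[set i | z ^+ W i == 1%R]|)%N -> z ^+ quasi_period W r = 1.
Proof.
move=> [n n_gt0 zn] r_lt; have [m z_prim _] := prim_order_exists n_gt0 zn.
set A := [set i | _] in r_lt; pose I := [set i in take r.+1 (enum A)].
have cardI : #|I| == r.+1.
  rewrite cardsE (card_uniqP _) ?take_uniq ?enum_uniq //.
  by rewrite size_takel // -cardE.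
apply/eqP; rewrite -(prim_order_dvd z_prim); apply: (biglcmn_sup I) => //.
apply/dvdn_biggcdP => i; rewrite inE => /mem_take.
by rewrite mem_enum inE (prim_order_dvd z_prim).
Qed.

Theorem proposition18 (K : fieldType) (k : nat) (W : 'I_k -> nat)
    (W_gt0 : forall i : 'I_k, (0 < W i)%N)
    (W_gcd1 : \big[gcdn/0%N]_(i < k) W i = 1%N)
    (P : (lcm_weights W).-tuple {poly rat})
    (P_hilbert : is_hilbert_quasi_poly K W_gt0 P)
    (r : nat) (r_lt_k : (r < k)%N)
    (i j : 'I_(lcm_weights W))
    (ij : (j = i + quasi_period W r %[mod lcm_weights W])%N) :
  (tnth P j)`_r = (tnth P i)`_r.
Proof.
set d := lcm_weights W in P P_hilbert i j ij *; set D := quasi_period W r in ij.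
have d_gt0 : (0 < d)%N by apply: leq_trans (ltn_ord i).
(* The quasi-polynomial as a family indexed by all natural numbers, and over a
   field that contains the d-th roots of unity. *)
pose Q n : {poly algC} := map_poly ratr (tnth P (Ordinal (ltn_pmod n d_gt0))).
have Qd n : Q (n + d)%N = Q n.
  by rewrite /Q; congr (map_poly _ (tnth _ _)); apply: val_inj;
  rewrite /= modnDr.
have Q_ord (l : 'I_d) : Q l = map_poly ratr (tnth P l).
  by rewrite /Q; congr (map_poly _ (tnth _ _)); apply: val_inj;
  rewrite /= modn_small.
have QD : (Q j)`_r = (Q (i + D)%N)`_r.
  rewrite /Q; congr (map_poly _ (tnth _ _))`_r; apply: val_inj => /=.
  by rewrite ij.
have [N HN] := P_hilbert.
have QN n : (N <= n)%N -> (face_count W [::] n)%:R = (Q n).[n%:R].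
  move=> Nn; rewrite -(hilbert_funE W K W_gt0).
  rewrite -[LHS](ratr_nat algC) -[in RHS](ratr_nat algC) horner_map /=.
  by rewrite (HN n (Ordinal (ltn_pmod n d_gt0))) //= modn_mod.
pose es := map W (enum 'I_k).
have es0 n : poly_diffs es Q n = 0.
  apply: (periodic_poly_eq0 d d_gt0 _ N.+1) n => [|n Nn].
    exact: poly_diffs_periodic.
  rewrite -(horner_poly_diffs es Q _ N QN) ?(ltnW Nn) //.
  rewrite diffs_face_count ?enum_uniq // face_count_enum //.
  by rewrite ltn_addr // (leq_trans _ Nn).
have [w w_prim] := C_prim_root_exists d_gt0.
have coef0 z : z ^+ d = 1 -> z ^+ D != 1 -> (fourier d z Q)`_r = 0.
  move=> zd zD; apply: nth_default.
  have es_gt0 : all (leq 1) es by apply/allP => _ /mapP [l _ ->].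
  apply: leq_trans (size_fourier_poly_diffs d es Q z zd Qd es_gt0) _.
  rewrite {1}/fourier big1 ?size_poly0 => [|l _]; last by rewrite es0 scaler0.
  rewrite add0n leqNgt; apply: contra zD => r_lt; apply/eqP.
  apply: expr_quasi_period; first by exists d.
  rewrite cardsE cardE /enum_mem size_filter -enumT; move: r_lt.
  by rewrite count_map => /leq_trans; apply; apply/eq_leq/eq_count.
apply: (fmorph_inj (@ratr algC)); rewrite -!coef_map -!Q_ord QD.
apply: (fourier_support_period d d_gt0 (fun n => (Q n)`_r) w D)
  => // [n|z zd zD].
  by rewrite Qd.
apply: etrans (coef0 z zd zD); rewrite /fourier coef_sum.
by apply: eq_bigr => n _; rewrite coefZ.
Qed.
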